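(* Let $u\in\mathbb{R}^m$. If there exists $b\in\mathbb{R}^p$ with $\mathcal{P}(b)\neq\emptyset$ such that $$K^+\overline{g}_{\mathcal{P}}(u,b)+K^-\underline{g}_{\mathcal{P}}(u,b)\le b\quad\text{and}\quad L^+\overline{\psi}_{\mathcal{P}}(u,b)+L^-\underline{\psi}_{\mathcal{P}}(u,b)\le 0,$$ then $u$ is feasible, i.e. there exists $x\in\mathbb{R}^n$ with $f(x,u)=0$ and $h(x,u)\le 0$.
   Context: Let $f:\mathbb{R}^n\times\mathbb{R}^m\to\mathbb{R}^n$ and $h:\mathbb{R}^n\times\mathbb{R}^m\to\mathbb{R}^r$ be continuous and differentiable, with $f=M\psi$, $h=L\psi$ for a continuously differentiable $\psi:\mathbb{R}^n\times\mathbb{R}^m\to\mathbb{R}^q$ and constant matrices $M\in\mathbb{R}^{n\times q}$, $L\in\mathbb{R}^{r\times q}$. There is a base point $(x_0,u_0)$ with $f(x_0,u_0)=0$, $h(x_0,u_0)\le0$, at which $J_{f,0}=\frac{\partial f}{\partial x}\big|_{(x_0,u_0)}$ is nonsingular; $J_{\psi,0}=\frac{\partial \psi}{\partial x}\big|_{(x_0,u_0)}$ and $g(x,u)=\psi(x,u)-J_{\psi,0}x$. Let $\underline{g},\overline{g},\underline{\psi},\overline{\psi}:\mathbb{R}^n\times\mathbb{R}^m\to\mathbb{R}^q$ satisfy $\underline{g}_k\le g_k\le\overline{g}_k$ and $\underline{\psi}_k\le\psi_k\le\overline{\psi}_k$ everywhere for each $k$. A fixed matrix $A\in\mathbb{R}^{p\times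 n}$ is chosen so that $\mathcal{P}(b)=\{x:Ax\le b\}$ is bounded for every $b$. Define $\overline{g}_{\mathcal{P},k}(u,b)=\max_{x\in\mathcal{P}(b)}\overline{g}_k(x,u)$, $\underline{g}_{\mathcal{P},k}(u,b)=\min_{x\in\mathcal{P}(b)}\underline{g}_k(x,u)$, $\overline{\psi}_{\mathcal{P},k}(u,b)=\max_{x\in\mathcal{P}(b)}\overline{\psi}_k(x,u)$, $\underline{\psi}_{\mathcal{P},k}(u,b)=\min_{x\in\mathcal{P}(b)}\underline{\psi}_k(x,u)$ (assumed attained). Let $K=-AJ_{f,0}^{-1}M$. For a matrix $N$, $N^+$ keeps the positive entries of $N$ and sets others to $0$, and $N^-$ keeps the negative entries and sets others to $0$. $u$ is feasible if there is $x$ with $f(x,u)=0$ and $h(x,u)\le0$. Vector inequalities are componentwise. *)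

(* Defs.v *)
From HB Require Import structures.
From mathcomp Require Import all_boot all_order all_algebra.
From mathcomp Require Import all_classical all_reals all_analysis.
Set Implicit Arguments. Unset Strict Implicit. Unset Printing Implicit Defensive.
Import Order.TTheory GRing.Theory Num.Theory.
Import numFieldNormedType.Exports.
Local Open Scope ring_scope.

Definition lev (R : realType) (k : nat) (a b : 'cV[R]_k) : Prop :=
  forall i, a i 0 <= b i 0.

Definition mxpos (R : realType) (k l : nat) (N : 'M[R]_(k, l)) : 'M[R]_(k, l) :=
  \matrix_(i, j) (if 0 < N i j then N i j else 0).
Definition mxneg (R : realType) (k l : nat) (N : 'M[R]_(k, l)) : 'M[R]_(k, l) :=
  \matrix_(i, j) (if N i j < 0 then N i j else 0).

Definition inP (R : realType) (p n : nat) (A : 'M[R]_(p, n)) (b : 'cV[R]_p)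
  (x : 'cV[R]_n) : Prop := lev (A *m x) b.

Definition P_bounded (R : realType) (p n : nat) (A : 'M[R]_(p, n)) (b : 'cV[R]_p)
  : Prop := exists r : R, forall x, inP A b x -> forall i, `|x i 0| <= r.

Definition pjacx (R : realType) (n m k : nat)
  (F : 'cV[R]_n -> 'cV[R]_m -> 'cV[R]_k) (x0 : 'cV[R]_n) (u0 : 'cV[R]_m)
  : 'M[R]_(k, n) :=
  \matrix_(i, j) ('D_(delta_mx j 0) (fun x => F x u0) x0) i 0.

Definition uncurry2 (R : realType) (n m k : nat)
  (F : 'cV[R]_n -> 'cV[R]_m -> 'cV[R]_k) : 'cV[R]_n * 'cV[R]_m -> 'cV[R]_k :=
  fun z => F z.1 z.2.

(* Main.v *)
(* Put T x = x - J^-1 f(x, u), where J = J_{f,0} = M J_{psi,0}. Then T x = - J^-1 M g(x, u), hence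
   A (T x) = K g(x, u), and the first inequality says that T maps the nonempty compact convex set
   P(b) into itself. Brouwer's theorem gives a fixed point of T in P(b), that is a zero of f(., u),
   and there the second inequality bounds h = L psi by 0.

   Brouwer's theorem on a cube follows from a labelling lemma on a grid. For labellings
   F_1, ..., F_n of the discrete torus (Z/(N+2))^n with F_j = 0 on the face x_j = 0 and F_j = 1 on
   the face x_j = N+1, let a_j be dF_j corrected by +1 on the edges in direction j that wrap
   around. The sum over all Kuhn simplices of the signed cup product of closed 1-cochains depends
   only on their cohomology classes, so for a_1, ..., a_n it equals its value 1 at the pure wrapping
   cochains. Some simplex therefore contributes; it does not wrap, and every F_j takes both values
   on it. Composing with the nearest-point projection carries the result from cubes to compact
   convex sets. *)
Require Import Defs.
From HB Require Import structures.
From mathcomp Require Import all_boot all_order all_algebra.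
From mathcomp Require Import all_fingroup.
From mathcomp Require Import all_classical all_reals all_analysis.
From mathcomp Require Import zify ring lra.
Import Order.TTheory GRing.Theory Num.Theory.
Import numFieldNormedType.Exports.
Local Open Scope ring_scope.

(** * Kuhn simplices, signed sums over them, and the cup product *)

Definition offset {n : nat} {T : zmodType} (e : 'I_n -> T) (s : 'S_n) (i : nat) : T :=
  \sum_(l < n | (l < i)%N) e (s l).

Definition alt_sum {n : nat} {T : finZmodType} (F : T -> 'S_n -> int) : int :=
  \sum_q \sum_(s : 'S_n) (-1) ^+ (odd_perm s) * F q s.

Lemma eq_alt_sum {n : nat} {T : finZmodType} (F F' : T -> 'S_n -> int) :
  (forall q s, F q s = F' q s) -> alt_sum F = alt_sum F'.
Proof. by move=> FF'; apply: eq_bigr => q _; apply: eq_bigr => s _; rewrite FF'. Qed.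

Lemma alt_sumD {n : nat} {T : finZmodType} (F F' : T -> 'S_n -> int) :
  alt_sum (fun q s => F q s + F' q s) = alt_sum F + alt_sum F'.
Proof.
rewrite -big_split; apply: eq_bigr => q _; rewrite -big_split.
by apply: eq_bigr => s _; rewrite mulrDr.
Qed.

Lemma alt_sumN {n : nat} {T : finZmodType} (F : T -> 'S_n -> int) :
  alt_sum (fun q s => - F q s) = - alt_sum F.
Proof.
rewrite -sumrN; apply: eq_bigr => q _; rewrite -sumrN.
by apply: eq_bigr => s _; rewrite mulrN.
Qed.

(** Multiplication by the transposition pairs simplices of opposite signs and equal values, so the
    sum is its own negative in [int]. *)
Lemma alt_sum_tperm {n : nat} {T : finZmodType} (F : T -> 'S_n -> int) (i j : 'I_n) :
  i != j -> (forall q s, F q (tperm i j * s)%g = F q s) -> alt_sum F = 0.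
Proof.
move=> ij Ftp; suff: alt_sum F = - alt_sum F by lia.
rewrite -alt_sumN; apply: eq_bigr => q _.
rewrite (reindex_inj (mulgI (tperm i j))); apply: eq_bigr => s _.
by rewrite odd_permM odd_tperm ij Ftp signr_addb mulN1r mulrN mulNr.
Qed.

Lemma alt_sum_shift {n : nat} {T : finZmodType} (F F' : T -> 'S_n -> int)
    (c : 'S_n) (h : 'S_n -> T) :
  (forall q s, F q s = F' (q + h s) (c * s)%g) ->
  alt_sum F = (-1) ^+ (odd_perm c) * alt_sum F'.
Proof.
move=> FF'; rewrite /alt_sum exchange_big [X in _ * X]exchange_big /=.
rewrite [X in _ * X](reindex_inj (mulgI c)) mulr_sumr; apply: eq_bigr => s _.
rewrite [X in _ * X](reindex_inj (addIr (h s))) mulr_sumr; apply: eq_bigr => q _.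
by rewrite FF' odd_permM signr_addb -mulrA signrMK.
Qed.

Lemma offsetS {n : nat} {T : zmodType} (e : 'I_n -> T) (s : 'S_n) (i : 'I_n) :
  offset e s i.+1 = offset e s i + e (s i).
Proof.
rewrite /offset (bigD1 i) //= addrC; congr (_ + _).
by apply: eq_bigl => l; rewrite ltnS [RHS]ltn_neqAle andbC.
Qed.

(** Swapping the edges [i] and [j] moves only the vertices that lie between them along the path. *)
Lemma offset_tperm {n : nat} {T : zmodType} (e : 'I_n -> T) (s : 'S_n) (i j : 'I_n) g :
  (i < g)%N = (j < g)%N -> offset e (tperm i j * s)%g g = offset e s g.
Proof.
move=> ijg; rewrite /offset [RHS](reindex_inj (@perm_inj _ (tperm i j))) /=.
apply: eq_big => [l|l _]; last by rewrite permM.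
by case: tpermP => // ->.
Qed.

(** The permutation [lift_perm ord_max ord0 1] raises each position by one and sends the last to the
    first, so the edge [s ord0] now comes last. *)
Lemma offset_cycle {n : nat} {T : zmodType} (e : 'I_n.+1 -> T) (s : 'S_n.+1) i :
  (i <= n)%N ->
  offset e s i.+1 = e (s ord0) + offset e (lift_perm ord_max ord0 1 * s)%g i.
Proof.
move=> le_in; rewrite /offset (bigD1_ord ord0) //=; congr (_ + _).
rewrite [RHS]big_mkcond big_ord_recr /= ltnNge le_in addr0 -big_mkcond /=.
apply: eq_big => [l|l _]; first by rewrite /= /bump leq0n add1n ltnS.
have -> : widen_ord (leqnSn n) l = lift ord_max l.
  by apply: val_inj; rewrite [RHS]lift_max.
by rewrite permM lift_perm_lift perm1.
Qed.

(* The vertices of the Kuhn simplex (q, s) are q + offset e s i for 0 <= i <= n, and a i x k is the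
   value of the 1-cochain a i on the edge from x to x + e k: the summand is the cup product. *)
Definition wedge {n : nat} {T : finZmodType} (e : 'I_n -> T)
    (a : 'I_n -> T -> 'I_n -> int) : int :=
  alt_sum (fun q s => \prod_i a i (q + offset e s i) (s i)).

(** Zero circulation around elementary squares: a diagonal then gets a well-defined value, which is
    closedness on the Kuhn triangles. *)
Definition closed_form {n : nat} {T : zmodType} (e : 'I_n -> T)
    (a : T -> 'I_n -> int) : Prop :=
  forall x k l, k != l -> a x k + a (x + e k) l = a x l + a (x + e l) k.

(** * Vanishing of the cup product when one factor is exact *)

Section Exact.
Variables (n : nat) (T : finZmodType) (e : 'I_n.+1 -> T).
Variables (b : 'I_n -> T -> 'I_n.+1 -> int) (G : T -> int).
Hypothesis b_closed : forall i, closed_form e (b i).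

(* One edge of the Kuhn simplex, at position t, is left out of the product, and G is evaluated at
   the vertex number g. *)
Definition skip_prod (t : 'I_n.+1) (g : nat) (q : T) (s : 'S_n.+1) : int :=
  (\prod_(i < n) b i (q + offset e s (lift t i)) (s (lift t i)))
  * G (q + offset e s g).

(* Closedness makes the sum of the two integrands invariant under exchanging the directions of the
   edges t and t + 1, which flips the sign of the simplex. *)
Lemma skip_prod_swap (t : 'I_n) g : g != t.+1 ->
  alt_sum (skip_prod (lift ord_max t) g) = - alt_sum (skip_prod (lift ord0 t) g).
Proof.
move=> gt; apply/eqP; rewrite -addr_eq0 -alt_sumD.
have vtl := lift_max t; have vtr := lift0 t.
move: (lift ord_max t) (lift ord0 t) vtl vtr => tl tr vtl vtr.
have tlr : tl != tr by rewrite -val_eqE /= vtl vtr; lia.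
apply/eqP; apply: (alt_sum_tperm _ tl tr) => // q s.
rewrite /skip_prod !offset_tperm; last by rewrite vtl vtr; lia.
rewrite -!mulrDl; congr (_ * _).
have lrt : lift tr t = tl by apply: val_inj; rewrite /= /bump vtl vtr ltnn.
have llt : lift tl t = tr by apply: val_inj; rewrite /= /bump vtl vtr leqnn.
have ll i : i != t -> lift tl i = lift tr i.
  move=> it; apply: val_inj; rewrite /= /bump vtl vtr.
  by move: it; rewrite -val_eqE /=; lia.
have lle i : i != t -> (lift tl i != tl) && (lift tl i != tr).
  by move=> it; rewrite eq_sym neq_lift (ll i it) eq_sym neq_lift.
have expand s' : \prod_(i < n) b i (q + offset e s' (lift tl i)) (s' (lift tl i))
  + \prod_(i < n) b i (q + offset e s' (lift tr i)) (s' (lift tr i)) =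
  (b t (q + offset e s' tl) (s' tl) + b t (q + offset e s' tl + e (s' tl)) (s' tr))
  * \prod_(i < n | i != t) b i (q + offset e s' (lift tl i)) (s' (lift tl i)).
  rewrite (bigD1 t) // [X in _ + X](bigD1 t) // llt lrt.
  rewrite [X in _ + _ * X](eq_bigr (fun i => b i (q + offset e s' (lift tl i))
    (s' (lift tl i)))); last by move=> i /ll ->.
  have -> : offset e s' tr = offset e s' tl + e (s' tl) by rewrite vtr -vtl offsetS.
  by rewrite -mulrDl addrA [X in X * _]addrC.
rewrite !expand !permM tpermL tpermR offset_tperm; last by rewrite vtl vtr; lia.
rewrite b_closed; last by rewrite (inj_eq perm_inj) eq_sym.
congr (_ * _); apply: eq_bigr => i /[dup] it /lle /andP[nl nr].
rewrite permM tpermD 1?eq_sym // offset_tperm //.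
by move: nl nr; rewrite -!val_eqE /= vtl vtr; lia.
Qed.

(** Each swap moves the skipped edge one place on and costs a sign; the condition on [g] keeps the
    vertex of [G] fixed by all of them. *)
Lemma skip_prod_chain d (t t' : 'I_n.+1) g : t' = (t + d)%N :> nat ->
  ~~ (t < g <= t')%N ->
  alt_sum (skip_prod t g) = (-1) ^+ d * alt_sum (skip_prod t' g).
Proof.
elim: d t => [|d IH] t tt' gt.
  have -> : t' = t by apply: val_inj; rewrite /= tt' addn0.
  by rewrite mul1r.
have ltn : (t < n)%N by have := ltn_ord t'; lia.
have -> : t = lift ord_max (Ordinal ltn) by apply: val_inj; rewrite [RHS]lift_max.
rewrite skip_prod_swap /=; last by lia.
by rewrite (IH (lift ord0 (Ordinal ltn))) ?lift0 /=; [rewrite exprS mulN1r mulNr|lia|lia].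
Qed.

(* The simplex obtained by moving the first edge to the end, based at q + e (s 0), shares the
   remaining vertices; this is where the absence of boundary of the torus enters. *)
Lemma skip_prod_cycle (c : 'I_n.+1) :
  alt_sum (skip_prod ord0 c.+1) = (-1) ^+ n * alt_sum (skip_prod ord_max c).
Proof.
rewrite (alt_sum_shift _ (skip_prod ord_max c)
  (lift_perm ord_max ord0 1) (fun s => e (s ord0))).
  by rewrite odd_lift_perm odd_perm1 addbF addbF signr_odd.
move=> q s; have le_cn : (c <= n)%N by rewrite -ltnS.
rewrite /skip_prod offset_cycle // addrA; congr (_ * _).
apply: eq_bigr => i _.
by rewrite permM lift_perm_lift perm1 lift0 lift_max offset_cycle ?addrA // ltnW.
Qed.

(* The two terms of dG are skip_prod at position c with G evaluated at either end of the skipped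
   edge. They are equal: moving the skipped edge away from G to the two ends of the simplex costs
   (-1)^c and (-1)^(n - c), and the cyclic rotation exchanging the ends costs (-1)^n. *)
Lemma wedge_exact (a : 'I_n.+1 -> T -> 'I_n.+1 -> int) (c : 'I_n.+1) :
  (forall x k, a c x k = G (x + e k) - G x) ->
  (forall i, a (lift c i) = b i) ->
  wedge e a = 0.
Proof.
move=> aG ab; rewrite /wedge.
rewrite (eq_alt_sum _ (fun q s => skip_prod c c.+1 q s + - skip_prod c c q s)).
  rewrite alt_sumD alt_sumN; apply/eqP; rewrite subr_eq0; apply/eqP.
  have := skip_prod_chain c ord0 c c.+1 erefl.
  rewrite skip_prod_cycle ltnn andbF => /(_ isT)/(canLR (signrMK _)) <-.
  have -> := skip_prod_chain (n - c) c ord_max c.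
  - rewrite mulrA -exprD; congr (_ * _); apply/eqP.
    rewrite -signr_odd -[X in _ == X]signr_odd; apply/eqP; congr (_ ^+ _).
    by have := ltn_ord c; lia.
  - by have /= := ltn_ord c; lia.
  - by rewrite ltnn.
move=> q s; rewrite (bigD1_ord c) // aG /skip_prod offsetS addrA.
under eq_bigr do rewrite ab.
by apply: etrans (mulrBl _ _ _) _; rewrite ![_ * \prod_(i < _) _]mulrC.
Qed.

End Exact.

(** By multilinearity the difference is the product whose factor [c] is the coboundary of [G], and
    [wedge_exact] kills it. *)
Lemma wedge_add_exact1 {n : nat} {T : finZmodType} (e : 'I_n -> T)
    (a a' : 'I_n -> T -> 'I_n -> int) (c : 'I_n) (G : T -> int) :
  (forall i, i != c -> closed_form e (a i)) ->
  (forall i, i != c -> a' i = a i) ->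
  (forall x k, a' c x k = a c x k + (G (x + e k) - G x)) ->
  wedge e a' = wedge e a.
Proof.
case: n e a a' c => [|n] e a a' c; first by case: c.
move=> a_closed aa' a'c; apply/eqP; rewrite -subr_eq0; apply/eqP.
pose d i := if i == c then fun x k => G (x + e k) - G x else a i.
rewrite -[RHS](@wedge_exact n T e (fun i => a (lift c i)) G _ d c); first last.
- by move=> i; rewrite /d eq_sym (negbTE (neq_lift _ _)).
- by move=> x k; rewrite /d eqxx.
- by move=> i; apply: a_closed; rewrite eq_sym neq_lift.
rewrite -alt_sumN -alt_sumD; apply: eq_alt_sum => q s.
rewrite (bigD1 c) //= a'c [X in _ - X](bigD1 c) //= [RHS](bigD1 c) //= {1}/d eqxx.
rewrite (eq_bigr (fun i => a i (q + offset e s i) (s i))); last by move=> i /aa' ->.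
rewrite [in RHS](eq_bigr (fun i => a i (q + offset e s i) (s i))); last first.
  by move=> i /negbTE ic; rewrite /d ic.
by ring.
Qed.

Lemma wedge_add_exact {n : nat} {T : finZmodType} (e : 'I_n -> T)
    (a : 'I_n -> T -> 'I_n -> int) (F : 'I_n -> T -> int) :
  (forall i, closed_form e (a i)) ->
  wedge e (fun i x k => a i x k + (F i (x + e k) - F i x)) = wedge e a.
Proof.
move=> a_closed.
(* Only the first [m] factors are corrected, so consecutive [m] differ in one factor. *)
pose a' (m : nat) i x k := a i x k + (if (i < m)%N then F i (x + e k) - F i x else 0).
have -> : wedge e a = wedge e (a' 0%N).
  apply: eq_alt_sum => q s; apply: eq_bigr => i _.
  by rewrite /a' ltn0 addr0.
have -> : wedge e (fun i x k => a i x k + (F i (x + e k) - F i x)) = wedge e (a' n).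
  by apply: eq_alt_sum => q s; apply: eq_bigr => i _; rewrite /a' ltn_ord.
suff partial m : (m <= n)%N -> wedge e (a' m) = wedge e (a' 0%N) by exact: partial.
elim: m => [//|m IH] ltmn; rewrite -IH; last exact: ltnW.
apply: (wedge_add_exact1 _ _ _ (Ordinal ltmn) (F (Ordinal ltmn))).
- move=> i _ x k l kl; rewrite /a'; have clos := a_closed i x k l kl.
  case: (i < m)%N; last by rewrite !addr0.
  by rewrite addrACA [RHS]addrACA clos [x + e k + e l]addrAC; congr (_ + _); ring.
- move=> i im; have {}im : (i < m.+1)%N = (i < m)%N.
    by rewrite ltnS leq_eqVlt (negbTE (im : i != m :> nat)).
  by apply/funext => x; apply/funext => k; rewrite /a' im.
- by move=> x k; rewrite /a' /= ltnSn ltnn addr0.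
Qed.

(** * The discrete torus and the labelling lemma *)

Section Torus.
Variables (n N : nat).
Local Notation T := 'rV['I_N.+2]_n.

(** Addition in ['I_N.+2] is modulo N + 2, which closes the grid up into a torus. *)
Definition unit_step (k : 'I_n) : T := delta_mx 0 k.

Lemma unit_step_neq (x : T) (k j : 'I_n) : j != k -> (x + unit_step k) 0 j = x 0 j.
Proof. by move=> jk; rewrite !mxE (negbTE jk) andbF addr0. Qed.

Lemma unit_step_lt (x : T) (k : 'I_n) : x 0 k != ord_max ->
  (x + unit_step k) 0 k = (x 0 k).+1 :> nat.
Proof.
move=> xk; have lt_x : (x 0%R k < N.+1)%N.
  by move: xk (ltn_ord (x 0 k)); rewrite -val_eqE /=; lia.
by rewrite !mxE !eqxx /= !modn_small // addn1.
Qed.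

Lemma unit_step_max (x : T) (k : 'I_n) : x 0 k = ord_max -> (x + unit_step k) 0 k = 0.
Proof.
by move=> xk; apply: val_inj; rewrite !mxE !eqxx xk /= addn1 modnn.
Qed.

(* The edge in direction j leaving ord_max returns to 0: wrap_form j is the lift of the generator
   of the cohomology of the j-th circle. *)
Definition wrap_form (j : 'I_n) (x : T) (k : 'I_n) : int :=
  ((k == j) && (x 0 j == ord_max))%:R.

Lemma wrap_form_closed j : closed_form unit_step (wrap_form j).
Proof.
have stepE x k l : k != l -> wrap_form j (x + unit_step k) l = wrap_form j x l.
  move=> kl; rewrite /wrap_form; case: eqVneq => //= lj.
  by rewrite unit_step_neq // eq_sym -lj.
by move=> x k l kl; rewrite (stepE _ _ _ kl) stepE ?[l == k]eq_sym // addrC.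
Qed.

Lemma offset_step (s : 'S_n) (i : nat) (q : T) (j : 'I_n) :
  (q + offset unit_step s i) 0 j =
  if (s^-1%g j < i)%N then (q + unit_step j) 0 j else q 0 j.
Proof.
have neq l : l != s^-1%g j -> unit_step (s l) 0 j = 0.
  move=> lj; have /negbTE jl : j != s l by apply: contraNneq lj => ->; rewrite permK.
  by rewrite mxE jl andbF.
rewrite mxE summxE; case: ifP => [lti|/negbT nlti].
  rewrite (bigD1 (s^-1%g j)) //= big1 => [|l /andP[_ /neq]//].
  by rewrite permKV addr0 [RHS]mxE.
rewrite big1 ?addr0 // => l li; apply: neq.
by apply: contraNneq nlti => <-.
Qed.

(** A nonzero factor [i] forces [s i = i]. For [s = 1], vertex [i] still has the [i]-th coordinate
    of [q], so only the base point with all coordinates [ord_max] contributes. *)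
Lemma wedge_wrap_form : wedge unit_step wrap_form = 1.
Proof.
rewrite /wedge /alt_sum (bigD1 (const_mx ord_max)) //= (bigD1 1%g) //=.
have prod0 (q : T) (s : 'S_n) i : ~~ ((s i == i) && ((q + offset unit_step s i) 0 i == ord_max)) ->
    (-1) ^+ odd_perm s *
    \prod_i wrap_form i (q + offset unit_step s i) (s i) = 0.
  by move=> h; rewrite (bigD1 i) //= /wrap_form (negbTE h) mul0r mulr0.
rewrite odd_perm1 mul1r big1 => [|i _]; last first.
  by rewrite /wrap_form offset_step invg1 !perm1 ltnn mxE !eqxx.
rewrite big1 ?addr0 => [|s s1]; last first.
  have /existsP[i si] : [exists i, s i != i].
    apply: contraNT s1; rewrite negb_exists => /forallP h.
    by apply/eqP/permP => i; rewrite perm1; apply/eqP; rewrite -[_ == _]negbK.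
  by rewrite (prod0 _ _ i) // (negbTE si).
rewrite big1 ?addr0 // => q qmax; rewrite big1 // => s _.
have [->|s1] := eqVneq s 1%g.
  have /existsP[i qi] : [exists i, q 0 i != ord_max].
    apply: contraNT qmax; rewrite negb_exists => /forallP h.
    by apply/eqP/rowP => i; rewrite mxE; apply/eqP; rewrite -[_ == _]negbK.
  by rewrite (prod0 _ _ i) // offset_step invg1 !perm1 ltnn (negbTE qi) andbF.
have /existsP[i si] : [exists i, s i != i].
  apply: contraNT s1; rewrite negb_exists => /forallP h.
  by apply/eqP/permP => i; rewrite perm1; apply/eqP; rewrite -[_ == _]negbK.
by rewrite (prod0 _ _ i) // (negbTE si).
Qed.

Lemma cubical_sperner (lab : 'I_n -> T -> bool) :
  (forall j (x : T), x 0 j = 0 -> lab j x = false) ->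
  (forall j (x : T), x 0 j = ord_max -> lab j x = true) ->
  exists q : 'I_n -> nat, forall i, exists y z : T,
    [/\ ~~ lab i y, lab i z &
      forall j, (q j <= y 0%R j <= (q j).+1)%N && (q j <= z 0%R j <= (q j).+1)%N].
Proof.
move=> lab0 lab1.
pose a i (x : T) k : int := wrap_form i x k + ((lab i (x + unit_step k))%:R - (lab i x)%:R).
have: wedge unit_step a != 0.
  have -> : wedge unit_step a = wedge unit_step wrap_form.
    exact: (wedge_add_exact _ wrap_form (fun i x => (lab i x)%:R) wrap_form_closed).
  by rewrite wedge_wrap_form.
have [/existsP[q /existsP[s nz]] _|none] :=
  boolP [exists q : T, [exists s : 'S_n,
    \prod_i a i (q + offset unit_step s i) (s i) != 0]]; last first.
  rewrite /wedge /alt_sum big1 ?eqxx // => q _; rewrite big1 // => s _.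
  move: none; rewrite negb_exists => /forallP /(_ q).
  by rewrite negb_exists => /forallP /(_ s); rewrite negbK => /eqP ->; rewrite mulr0.
have {}nz i : a i (q + offset unit_step s i) (s i) != 0.
  by apply: contraNneq nz => ai; rewrite (bigD1 i) //= ai mul0r.
(* Otherwise vertex [j] lies on a face where label [j] is prescribed: if its edge wraps, the label
   drop cancels the 1 of [wrap_form]; if not, the label is constant along it. Either way factor [j]
   vanishes. *)
have qmax j : q 0 j != ord_max.
  apply: contra (nz j) => /eqP qj; rewrite /a /wrap_form.
  set x := q + offset unit_step s j.
  have xj : x 0 j = ord_max \/ x 0 j = 0.
    by rewrite /x offset_step; case: ifP => _; [right; exact: unit_step_max|left].
  have [sj|sj] := eqVneq (s j) j.
    have {}xj : x 0 j = ord_max by rewrite /x offset_step -{1}sj permK ltnn.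
    rewrite sj (lab1 _ _ xj) lab0; last exact: unit_step_max.
    by rewrite xj eqxx.
  have stepj : (x + unit_step (s j)) 0 j = x 0 j by rewrite unit_step_neq // eq_sym.
  by case: xj => xj; [rewrite !lab1 ?stepj|rewrite !lab0 ?stepj]; rewrite ?subrr.
exists (fun j => nat_of_ord (q 0 j)) => i.
set x := q + offset unit_step s i.
have xE j : (q 0%R j <= x 0%R j <= (q 0%R j).+1)%N.
  rewrite /x offset_step; by case: ifP => _; rewrite ?unit_step_lt // leqnn leqnSn.
have x'E j : (q 0%R j <= (x + unit_step (s i))%R 0%R j <= (q 0%R j).+1)%N.
  rewrite /x -addrA -offsetS offset_step; by case: ifP => _; rewrite ?unit_step_lt // leqnn leqnSn.
have := nz i; rewrite /a /wrap_form -/x.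
(* Without wrapping, [a i] is the bare label difference, so the two ends of the edge have different
   labels. *)
have -> : (s i == i) && (x 0 i == ord_max) = false.
  apply/negbTE; apply: contra (qmax i) => /andP[/eqP si].
  by rewrite /x offset_step -{1}si permK ltnn.
case labx: (lab i x); case labx': (lab i (x + unit_step (s i))) => //= _.
- by exists (x + unit_step (s i)), x; split=> [||j]; rewrite ?labx ?labx' ?xE ?x'E.
- by exists x, (x + unit_step (s i)); split=> [||j]; rewrite ?labx ?labx' ?xE ?x'E.
Qed.

End Torus.

(** * From labellings to fixed points on a cube *)

Lemma fixpoint_approx (R : realType) (n : nat) (H : 'rV[R]_n -> 'rV[R]_n) (r e : R) :
  0 <= r -> 0 < e -> (forall x i, `|H x 0 i| <= r) ->
  exists x : 'rV[R]_n, (forall j, `|x 0 j| <= r) /\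
  forall i, exists y z : 'rV[R]_n,
    [/\ forall j, `|x 0 j - y 0 j| < e, forall j, `|x 0 j - z 0 j| < e,
      y 0 i <= H y 0 i & H z 0 i <= z 0 i].
Proof.
move=> r0 e0 Hr.
(* This makes the mesh 2r/(N+1) smaller than [e]. *)
pose N := Num.truncn (2 * r / e).
have rN : 2 * r / N.+1%:R < e.
  rewrite ltr_pdivrMr ?ltr0n // [e * _]mulrC -ltr_pdivrMr //.
  by apply: truncnS_gt.
pose pt (v : 'I_n -> nat) : 'rV[R]_n := \row_j (2 * r / N.+1%:R * (v j)%:R - r).
pose crd (v : 'rV['I_N.+2]_n) (j : 'I_n) : nat := v 0 j.
(* Label 1 means that [H] lowers coordinate [i]; on the two faces the label is forced, consistently
   with the weak inequalities because [H] takes values in the cube. *)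
pose lab i (v : 'rV['I_N.+2]_n) :=
  (v 0 i != 0) && ((v 0 i == ord_max) || (H (pt (crd v)) 0 i < pt (crd v) 0 i)).
have [||q qP] := @cubical_sperner n N lab.
- by move=> j x xj; rewrite /lab xj eqxx.
- by move=> j x xj; rewrite /lab xj eqxx -val_eqE.
have pt_max v i : v i = N.+1 -> pt v 0 i = r.
  by move=> vi; rewrite mxE vi divfK ?pnatr_eq0 //; ring.
have pt_close (v w : 'I_n -> nat) j : (v j <= w j <= (v j).+1)%N ->
    `|pt v 0 j - pt w 0 j| < e.
  move=> /andP[vw wv]; rewrite !mxE.
  have /orP[/eqP ->|/eqP ->] : (w j == v j) || (w j == (v j).+1) by lia.
    by rewrite subrr normr0.
  rewrite -natr1 (_ : _ - _ = - (2 * r / N.+1%:R)); last by ring.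
  by rewrite normrN ger0_norm // divr_ge0 // mulr_ge0.
exists (pt q); split=> [j|i].
  have [y [_ [_ _ /(_ j)/andP[/andP[qy _] _]]]] := qP j.
  have := ltn_ord (y 0 j); rewrite ltnS => /(leq_trans qy) qN.
  rewrite mxE ler_norml; apply/andP; split.
    by rewrite lerDr mulr_ge0 // divr_ge0 // mulr_ge0.
  have : 2 * r / N.+1%:R * (q j)%:R <= 2 * r.
    by rewrite mulrAC ler_pdivrMr ?ltr0n // ler_wpM2l ?mulr_ge0 // ler_nat.
  by rewrite lerBlDr => /le_trans; apply; lra.
have [y [z [laby labz qyz]]] := qP i.
exists (pt (crd y)), (pt (crd z)); split=> [j|j||].
- by apply: pt_close; case/andP: (qyz j).
- by apply: pt_close; case/andP: (qyz j).
- move: laby; rewrite /lab negb_and negbK negb_or => /orP[/eqP yi|/andP[_]].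
    rewrite [X in X <= _]mxE /crd yi mulr0 sub0r.
    by have := Hr (pt (crd y)) i; rewrite ler_norml => /andP[].
  by rewrite -leNgt.
- move: labz; rewrite /lab => /andP[_ /orP[/eqP zi|/ltW//]].
  rewrite [X in _ <= X]pt_max; last by rewrite /crd zi.
  by have := Hr (pt (crd z)) i; rewrite ler_norml => /andP[].
Qed.

Local Open Scope classical_set_scope.

Lemma compact_box (R : realType) (n : nat) (r : R) :
  compact [set x : 'rV[R]_n | forall i, `|x 0 i| <= r].
Proof.
have -> : [set x : 'rV[R]_n | forall i, `|x 0 i| <= r] =
    [set x : 'rV[R]_n | forall i, `[- r, r] (x 0 i)].
  by apply/seteqP; split=> x h i; have := h i; rewrite /= in_itv /= ler_norml.
by apply: (@rV_compact _ _ (fun=> `[- r, r])) => _; exact: segment_compact.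
Qed.

Lemma continuous_fixpoint (R : realType) (n : nat) (H : 'rV[R]_n -> 'rV[R]_n) (r : R) :
  0 <= r -> continuous H -> (forall x i, `|H x 0 i| <= r) ->
  exists x, H x = x.
Proof.
move=> r0 Hc Hr.
have approx (k : nat) := @fixpoint_approx R n H r k.+1%:R^-1 r0
  (ltac:(by rewrite invr_gt0 ltr0n)) Hr.
have [xs xsP] := choice approx.
have [|/= x [_ xcl]] := @compact_box R n r (xs @ \oo) _.
  by exists 0%N => // k _; have [] := xsP k.
(* Half of the radius [e] brings [xs k] close to the cluster point [x], the other half covers the
   ball of radius 1/(k+1) around [xs k]. *)
have key (F : 'rV[R]_n -> R) : continuous F -> 0 < F x ->
    exists k, forall y : 'rV[R]_n, (forall j, `|xs k 0 j - y 0 j| < k.+1%:R^-1) -> 0 < F y.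
  move=> Fc Fx.
  have /nbhs_ballP[e /= e0 eF] : nbhs x [set y | 0 < F y].
    exact: cvgr_gt (Fc x) _ Fx.
  have e2 : 0 < e / 2 by rewrite divr_gt0.
  have near_small : \forall k \near \oo, k.+1%:R^-1 < e / 2 :> R.
    exact: near_infty_natSinv_lt (PosNum e2).
  have [_ [[k ke <-] xk]] : [set xs k | k in [set k | k.+1%:R^-1 < e / 2 :> R]]
      `&` ball x (e / 2) !=set0.
    apply: xcl; last exact: nbhsx_ballx.
    by apply: filterS near_small => k ke; exists k.
  exists k => y yk; apply: eF; rewrite [e]splitr; apply: ball_triangle xk _.
  by split=> // i j; rewrite ord1; apply: lt_trans (yk j) ke.
have Hi i : continuous (fun y => H y 0 i).
  move=> y; apply: (@continuous_comp _ _ _ H (fun M : 'rV[R]_n => M 0 i)).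
    exact: Hc.
  exact: coord_continuous.
exists x; apply/rowP => i; apply/eqP; rewrite eq_le !leNgt; apply/andP; split.
- apply/negP => lt_x; have [||k kP] := key (fun y => H y 0 i - y 0 i).
  + by move=> y; exact: cvgB (Hi i y) (@coord_continuous R 1 n 0 i y).
  + by rewrite subr_gt0.
  have [_ /(_ i)[_ [z [_ zk _ Hz]]]] := xsP k.
  by have := kP z zk; rewrite subr_gt0 ltNge Hz.
- apply/negP => lt_x; have [||k kP] := key (fun y => y 0 i - H y 0 i).
  + by move=> y; exact: cvgB (@coord_continuous R 1 n 0 i y) (Hi i y).
  + by rewrite subr_gt0.
  have [_ /(_ i)[y [_ [yk _ Hy _]]]] := xsP k.
  by have := kP y yk; rewrite subr_gt0 ltNge Hy.
Qed.

(** * Continuity and differentiation of matrix maps *)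

Lemma mx_continuous (R : realType) (U : topologicalType) (m n : nat)
    (f : U -> 'M[R]_(m, n)) :
  (forall i j, continuous (fun x => f x i j)) -> continuous f.
Proof.
move=> fc x; apply/cvg_ballP => e e0.
have fij i j : \forall y \near x, ball (f x i j) e (f y i j).
  by have /cvg_ballP := fc i j x; apply.
have fi i : \forall y \near x, forall j, ball (f x i j) e (f y i j).
  by apply: filter_forall => j; exact: fij.
have : \forall y \near x, forall i j, ball (f x i j) e (f y i j).
  by apply: filter_forall => i; exact: fi.
by apply: filterS => y fy; split.
Qed.

Lemma sum_continuous (R : realType) (U : topologicalType) (n : nat) (F : 'I_n -> U -> R) :
  (forall i, continuous (F i)) -> continuous (fun x => \sum_i F i x).
Proof.
move=> Fc; apply: (@continuous_big R _ _ _ _ _ U (index_enum _) F) => //.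
exact: add_continuous.
Qed.

Lemma mulmx_continuous (R : realType) (k m n : nat) (M : 'M[R]_(k, m)) :
  continuous (mulmx M : 'M[R]_(m, n) -> 'M[R]_(k, n)).
Proof.
apply: mx_continuous => i j.
have -> : (fun x : 'M[R]_(m, n) => (M *m x) i j) = fun x => \sum_l M i l * x l j.
  by apply/funext => x; rewrite mxE.
apply: sum_continuous => l x.
exact: cvgMr (@coord_continuous R m n l j x).
Qed.

Lemma trmx_continuous (R : realType) (m n : nat) :
  continuous (@trmx R m n).
Proof.
apply: mx_continuous => i j.
have -> : (fun x : 'M[R]_(m, n) => x^T i j) = fun x => x j i.
  by apply/funext => x; rewrite mxE.
exact: coord_continuous.
Qed.

Lemma derive_mulmx (R : realType) (V : normedModType R) (k m n : nat) (M : 'M[R]_(k, m))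
    (g : V -> 'M[R]_(m, n)) (x v : V) :
  differentiable g x -> 'D_v (fun y => M *m g y) x = M *m 'D_v g x.
Proof.
move=> dg; have dM y : differentiable (mulmx M : 'M[R]_(m, n) -> 'M[R]_(k, n)) y.
  by apply: linear_differentiable; exact: mulmx_continuous.
rewrite (deriveE v dg) (_ : (fun y => M *m g y) = mulmx M \o g) // deriveE.
  by rewrite diff_comp // diff_lin //; exact: mulmx_continuous.
exact: differentiable_comp.
Qed.

Lemma pjacx_mulmx (R : realType) (n m q k : nat) (M : 'M[R]_(k, q))
    (f : 'cV[R]_n -> 'cV[R]_m -> 'cV[R]_k) (g : 'cV[R]_n -> 'cV[R]_m -> 'cV[R]_q)
    (x : 'cV[R]_n) (u : 'cV[R]_m) :
  (forall x u, f x u = M *m g x u) -> differentiable (uncurry2 g) (x, u) ->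
  pjacx f x u = M *m pjacx g x u.
Proof.
move=> fE dg; apply/matrixP => i j; rewrite mxE [RHS]mxE.
have -> : (fun y => f y u) = (fun y => M *m g y u) by apply/funext => y.
rewrite derive_mulmx; last first.
  apply: (@differentiable_comp _ _ _ _ (fun y => (y, u)) (uncurry2 g)) => //.
by rewrite mxE; apply: eq_bigr => l _; rewrite [X in _ = _ * X]mxE.
Qed.

(** * Nearest-point projection and Brouwer's theorem on compact convex sets *)

Definition convex_subset {R : realType} {n : nat} (C : set 'rV[R]_n) : Prop :=
  forall x y t, C x -> C y -> 0 <= t <= 1 -> C (x + t *: (y - x)).

(** Otherwise a small step from [p] towards [y] would shorten the Euclidean distance to [x]. *)
Lemma nearest_point_obtuse (R : realType) (n : nat) (C : set 'rV[R]_n) (x p : 'rV[R]_n) :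
  convex_subset C -> C p ->
  (forall y, C y -> \sum_i (x 0 i - p 0 i) ^+ 2 <= \sum_i (x 0 i - y 0 i) ^+ 2) ->
  forall y, C y -> \sum_i (x 0 i - p 0 i) * (y 0 i - p 0 i) <= 0.
Proof.
move=> Cconv Cp pmin y Cy; rewrite leNgt; apply/negP.
set D := \sum_i _ => D0.
pose Q := \sum_i (y 0 i - p 0 i) ^+ 2.
have Q0 : 0 <= Q by apply: sumr_ge0 => i _; exact: sqr_ge0.
have quad t : 0 <= t <= 1 -> 0 <= t * (t * Q - 2 * D).
  move=> t01; have := pmin _ (Cconv p y t Cp Cy t01); rewrite -subr_ge0.
  congr (0 <= _); rewrite mulrBr /Q /D !mulr_sumr -!sumrB.
  by apply: eq_bigr => i _; rewrite !mxE; ring.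
have DQ : 0 < D + Q by rewrite ltr_wpDr.
(* For this step t Q = D - t D < 2 D, against [quad]. *)
pose t := D / (D + Q).
have t0 : 0 < t by rewrite divr_gt0.
have t1 : t <= 1 by rewrite ler_pdivrMr // mul1r lerDl.
have := quad t; rewrite (ltW t0) t1 => /(_ isT); rewrite pmulr_rge0 // leNgt.
have tE : t * (D + Q) = D by rewrite divfK // gt_eqF.
by case/negP; nra.
Qed.

Lemma convex_projection (R : realType) (n : nat) (C : set 'rV[R]_n) :
  compact C -> C !=set0 -> convex_subset C ->
  exists p : 'rV[R]_n -> 'rV[R]_n,
    [/\ continuous p, forall x, C (p x) & forall x, C x -> p x = x].
Proof.
move=> Ccpt C0 Cconv.
have dist_cont (x : 'rV[R]_n) : continuous (fun y : 'rV[R]_n => \sum_i (x 0 i - y 0 i) ^+ 2).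
  apply: sum_continuous => i y.
  have c : (fun y : 'rV[R]_n => x 0 i - y 0 i) @ y --> x 0 i - y 0 i.
    exact: cvgB (cvg_cst _) (@coord_continuous R 1 n 0 i y).
  exact: (cvgM c c).
have nearest (x : 'rV[R]_n) : exists p, C p /\
    forall y, C y -> \sum_i (x 0 i - p 0 i) ^+ 2 <= \sum_i (x 0 i - y 0 i) ^+ 2.
  have [p Cp pmin] := compact_EVT_min C0 Ccpt (continuous_subspaceT (dist_cont x)).
  by exists p; split=> [|y Cy]; [exact: set_mem|apply: pmin; exact: mem_set].
have [p pP] := choice nearest.
have Cp x : C (p x) by have [] := pP x.
(* Adding the obtuse-angle inequalities at [p x] and [p y] shows that [p] is nonexpansive, hence
   continuous. *)
have contract x y : \sum_i (p x 0 i - p y 0 i) ^+ 2 <= \sum_i (x 0 i - y 0 i) ^+ 2.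
  have ox := nearest_point_obtuse _ _ C x (p x) Cconv (Cp x) (pP x).2 _ (Cp y).
  have oy := nearest_point_obtuse _ _ C y (p y) Cconv (Cp y) (pP y).2 _ (Cp x).
  rewrite -subr_ge0 -sumrB.
  have -> : \sum_i ((x 0 i - y 0 i) ^+ 2 - (p x 0 i - p y 0 i) ^+ 2) =
    \sum_i (x 0 i - y 0 i - (p x 0 i - p y 0 i)) ^+ 2
    - 2 * (\sum_i (x 0 i - p x 0 i) * (p y 0 i - p x 0 i)
           + \sum_i (y 0 i - p y 0 i) * (p x 0 i - p y 0 i)).
    rewrite -big_split mulr_sumr -sumrB; apply: eq_bigr => i _ /=; ring.
  have : 0 <= \sum_i (x 0 i - y 0 i - (p x 0 i - p y 0 i)) ^+ 2.
    by apply: sumr_ge0 => i _; exact: sqr_ge0.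
  lra.
have pc : continuous p.
  move=> x; apply/(@cvg_ballP _ _ _ (nbhs x) _ p (p x)) => e e0.
  have : nbhs x [set y : 'rV[R]_n | \sum_i (x 0 i - y 0 i) ^+ 2 < e ^+ 2].
    apply: (cvgr_lt _ (dist_cont x x)).
    by rewrite big1 ?exprn_gt0 // => i _; rewrite subrr expr0n.
  apply: filterS => y xy; split=> // i j; rewrite ord1.
  have : (p x 0 j - p y 0 j) ^+ 2 < e ^+ 2.
    apply: le_lt_trans xy; apply: le_trans (contract x y).
    rewrite (bigD1 j) //= lerDl; apply: sumr_ge0 => k _; exact: sqr_ge0.
  move=> lt_e; rewrite /ball /= -(@ltr_pXn2r _ 2) ?nnegrE ?(ltW e0) //.
  by rewrite real_normK ?num_real.
exists p; split=> // x Cx.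
have := (pP x).2 x Cx; rewrite [X in _ <= X]big1 => [le0|i _]; last first.
  by rewrite subrr expr0n.
apply/rowP => i; apply/esym/eqP; rewrite -subr_eq0 -sqrf_eq0 eq_le sqr_ge0 andbT.
apply: le_trans le0; rewrite (bigD1 i) //= lerDl.
by apply: sumr_ge0 => k _; exact: sqr_ge0.
Qed.

Lemma brouwer (R : realType) (n : nat) (C : set 'rV[R]_n) (r : R)
    (T : 'rV[R]_n -> 'rV[R]_n) :
  closed C -> C !=set0 -> convex_subset C -> (forall x i, C x -> `|x 0 i| <= r) ->
  continuous T -> (forall x, C x -> C (T x)) -> exists2 x, C x & T x = x.
Proof.
move=> Ccl C0 Cconv Cr Tc TC.
have Ccpt : compact C.
  by apply: subclosed_compact Ccl (compact_box R n r) _ => x Cx i; exact: Cr.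
have [p [pc pC pid]] := convex_projection R n C Ccpt C0 Cconv.
have Tpc : continuous (T \o p).
  by move=> x; apply: continuous_comp; [exact: pc|exact: Tc].
(* The absolute value is taken because [r] may be negative when [n = 0]. *)
have Tpr x i : `|(T \o p) x 0 i| <= `|r|.
  by apply: le_trans (ler_norm r); apply/Cr/TC.
have [x Tx] := @continuous_fixpoint R n (T \o p) `|r| (normr_ge0 r) Tpc Tpr.
have Cx : C x by rewrite -Tx; exact/TC/pC.
by exists x => //; rewrite -[in LHS](pid x Cx).
Qed.

(** * The polytope and the feasibility of [u] *)

(** Positive entries of [N] give their largest contribution at [hi], negative ones at [lo]. *)
Lemma lev_mulmx_sign_split (R : realType) (k q : nat) (N : 'M[R]_(k, q))
    (lo v hi : 'cV[R]_q) :
  lev lo v -> lev v hi -> lev (N *m v) (mxpos N *m hi + mxneg N *m lo).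
Proof.
move=> lov vhi i; rewrite !mxE -big_split; apply: ler_sum => j _; rewrite !mxE /=.
have := lov j; have := vhi j.
by case: (ltrgt0P (N i j)) => N0 vh lv; nra.
Qed.

Lemma inP_closed (R : realType) (p n : nat) (A : 'M[R]_(p, n)) (b : 'cV[R]_p) :
  closed [set x : 'rV[R]_n | inP A b x^T].
Proof.
pose row i (x : 'rV[R]_n) : R := (A *m x^T) i 0.
have -> : [set x : 'rV[R]_n | inP A b x^T] =
    \bigcap_(i in setT) row i @^-1` [set y | y <= b i 0].
  by apply/seteqP; split=> x Px i; [move=> _; exact: Px|exact: Px].
apply: closed_bigI => i _; apply: preimage_closed; last exact: closed_le.
move=> x _; apply: (@continuous_comp _ _ _ (fun x => A *m x^T)
  (fun y : 'cV[R]_p => y i 0)); last exact: coord_continuous.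
apply: (@continuous_comp _ _ _ (@trmx R 1 n) (mulmx A)); first exact: trmx_continuous.
exact: mulmx_continuous.
Qed.

Lemma inP_convex (R : realType) (p n : nat) (A : 'M[R]_(p, n)) (b : 'cV[R]_p) :
  convex_subset [set x : 'rV[R]_n | inP A b x^T].
Proof.
move=> x y t Px Py /andP[t0 t1] i.
have := Px i; have := Py i.
rewrite linearD linearZ linearB /= mulmxDr -scalemxAr mulmxBr.
move: (A *m x^T) (A *m y^T) => Ax Ay; rewrite !mxE => Ayb Axb.
nra.
Qed.

Local Close Scope classical_set_scope.

Theorem theorem3 (R : realType) (n m q r p : nat)
  (f : 'cV[R]_n -> 'cV[R]_m -> 'cV[R]_n)
  (h : 'cV[R]_n -> 'cV[R]_m -> 'cV[R]_r)
  (psi : 'cV[R]_n -> 'cV[R]_m -> 'cV[R]_q)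
  (M : 'M[R]_(n, q)) (L : 'M[R]_(r, q))
  (x0 : 'cV[R]_n) (u0 : 'cV[R]_m)
  (gl gu psil psiu : 'cV[R]_n -> 'cV[R]_m -> 'cV[R]_q)
  (A : 'M[R]_(p, n))
  (gPl gPu psiPl psiPu : 'cV[R]_m -> 'cV[R]_p -> 'cV[R]_q)
  (u : 'cV[R]_m) :
  (* f, h continuous and differentiable *)
  continuous (uncurry2 f) -> (forall z, differentiable (uncurry2 f) z) ->
  continuous (uncurry2 h) -> (forall z, differentiable (uncurry2 h) z) ->
  (* psi continuously differentiable *)
  (forall z, differentiable (uncurry2 psi) z) ->
  (forall v, continuous (fun z => 'd (uncurry2 psi) z v)) ->
  (forall x u, f x u = M *m psi x u) ->
  (forall x u, h x u = L *m psi x u) ->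
  (* base point *)
  f x0 u0 = 0 -> lev (h x0 u0) 0 ->
  pjacx f x0 u0 \in unitmx ->
  let Jf0 := pjacx f x0 u0 in
  let Jpsi0 := pjacx psi x0 u0 in
  let g := fun x u => psi x u - Jpsi0 *m x in
  (* bounds on g and psi *)
  (forall x u k, gl x u k 0 <= g x u k 0 /\ g x u k 0 <= gu x u k 0) ->
  (forall x u k, psil x u k 0 <= psi x u k 0 /\ psi x u k 0 <= psiu x u k 0) ->
  (* P(b) bounded for every b *)
  (forall b, P_bounded A b) ->
  (* the maxima / minima over P(b) (attained, for nonempty P(b)) *)
  (forall u b, (exists x, inP A b x) -> forall k,
     (exists2 x, inP A b x & gPu u b k 0 = gu x u k 0) /\
     (forall x, inP A b x -> gu x u k 0 <= gPu u b k 0)) ->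
  (forall u b, (exists x, inP A b x) -> forall k,
     (exists2 x, inP A b x & gPl u b k 0 = gl x u k 0) /\
     (forall x, inP A b x -> gPl u b k 0 <= gl x u k 0)) ->
  (forall u b, (exists x, inP A b x) -> forall k,
     (exists2 x, inP A b x & psiPu u b k 0 = psiu x u k 0) /\
     (forall x, inP A b x -> psiu x u k 0 <= psiPu u b k 0)) ->
  (forall u b, (exists x, inP A b x) -> forall k,
     (exists2 x, inP A b x & psiPl u b k 0 = psil x u k 0) /\
     (forall x, inP A b x -> psiPl u b k 0 <= psil x u k 0)) ->
  let K := - (A *m invmx Jf0 *m M) in
  (exists b : 'cV[R]_p,
     (exists x, inP A b x) /\
     lev (mxpos K *m gPu u b + mxneg K *m gPl u b) b /\
     lev (mxpos L *m psiPu u b + mxneg L *m psiPl u b) 0) ->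
  exists x : 'cV[R]_n, f x u = 0 /\ lev (h x u) 0.
Proof.
move=> fc fd hc hd psid psic fE hE f0 h0 Junit Jf0 Jpsi0 g gb psib Pb gPuP gPlP psiPuP psiPlP K
  [b [Pb0 [Kb Lb]]].
have JfE : Jf0 = M *m Jpsi0 by exact: pjacx_mulmx.
pose T (x : 'cV[R]_n) := x - invmx Jf0 *m f x u.
(* Since f = M psi = M g + Jf0 x, the linear term cancels [x]. *)
have TE x : T x = - (invmx Jf0 *m M *m g x u).
  rewrite /g mulmxBr -!mulmxA -fE [M *m _]mulmxA -JfE mulKmx //.
  by rewrite opprB /T.
have TP x : inP A b x -> inP A b (T x).
  move=> Px i; apply: le_trans (Kb i).
  have -> : A *m T x = K *m g x u by rewrite TE mulmxN mulNmx !mulmxA.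
  apply: lev_mulmx_sign_split => k; have [gl_g g_gu] := gb x u k.
    exact: le_trans ((gPlP u b Pb0 k).2 x Px) gl_g.
  exact: le_trans g_gu ((gPuP u b Pb0 k).2 x Px).
(* The fixed-point theorem is stated for row vectors, hence the transposes. *)
have Tc : continuous (fun x : 'rV[R]_n => (T x^T)^T).
  have fuc : continuous (fun y : 'cV[R]_n => f y u).
    move=> y; apply: (@continuous_comp _ _ _ (fun y => (y, u)) (uncurry2 f)).
      by apply: (@cvg_pair _ _ _ (nbhs y) (nbhs y) (nbhs u) _ _ _ id (fun=> u));
        [exact: cvg_id|exact: cvg_cst].
    exact: fc.
  have Tc' : continuous T.
    move=> y; apply: (@continuousB _ _ _ id (fun y => invmx Jf0 *m f y u)).
      exact: cvg_id.
    apply: (@continuous_comp _ _ _ (fun y => f y u) (mulmx (invmx Jf0))).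
      exact: fuc.
    exact: mulmx_continuous.
  move=> x; apply: (@continuous_comp _ _ _ (fun x : 'rV[R]_n => T x^T) (@trmx R n 1)).
    apply: (@continuous_comp _ _ _ (@trmx R 1 n) T); last exact: Tc'.
    exact: trmx_continuous.
  exact: trmx_continuous.
have [bd Pbd] := Pb b.
have [x Px Tx] : exists2 x : 'rV[R]_n, inP A b x^T & (T x^T)^T = x.
  apply: (@brouwer R n _ bd _ (inP_closed R p n A b) _ (inP_convex R p n A b)) Tc _.
  - by have [x Px] := Pb0; exists x^T; rewrite /= trmxK.
  - by move=> x i Px; have := Pbd _ Px i; rewrite mxE.
  - by move=> x Px; rewrite /= trmxK; exact: TP.
exists x^T; split.
  have : T x^T = x^T by rewrite -[RHS](congr1 trmx Tx) trmxK.
  move/(congr1 (fun y => x^T - y)); rewrite /T subKr subrr => Jf.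
  by rewrite -(mulKVmx Junit (f _ u)) Jf mulmx0.
rewrite hE => i; apply: le_trans (Lb i).
apply: lev_mulmx_sign_split => k; have [l_psi psi_u] := psib x^T u k.
  exact: le_trans ((psiPlP u b Pb0 k).2 _ Px) l_psi.
exact: le_trans psi_u ((psiPuP u b Pb0 k).2 _ Px).
Qed.
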